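(* Let $X$ be a zero-dimensional Polish space with at least two points, and assume $\mathsf{AD}$ if $X$ is uncountable. Then the set of those $Y\in F(\mathcal N)$ such that $\mathcal W(Y)$ is order-isomorphic to $\mathcal W(X)$ is not Borel in the Effros Borel space $F(\mathcal N)$.
   Context: Base theory: $\mathsf{ZF}+\mathsf{DC}(\mathbb{R})$; $\mathsf{AD}$ is the Axiom of Determinacy. $\mathcal N=\omega^\omega$ is the Baire space and $F(\mathcal N)$ is the set of closed subsets of $\mathcal N$ with the Effros Borel structure; every zero-dimensional Polish space is homeomorphic to an element of $F(\mathcal N)$, and elements of $F(\mathcal N)$ are regarded as spaces with the subspace topology. For a space $Z$ and $A,B\subseteq Z$, $A\le_{\mathsf W}^Z B$ means there is a continuous $f\colon Z\to Z$ with $f^{-1}(B)=A$; the Wadge hierarchy $\mathcal W(Z)$ is the set of equivalence classes of the equivalence relation induced by $\le_{\mathsf W}^Z$ on $\mathscr P(Z)$, partially ordered by the induced order. *)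

(* Defs.v *)
(* Nothing here presupposes the axiom of choice, so that DC(R) and AD can be
   hypotheses of a theorem of choiceless mathematics.  A topologicalType of
   MathComp-Analysis carries a choice operator; with excluded middle it gives
   a choice function on the nonempty subsets of the space, which AD refutes for
   an uncountable Polish space.  Topological notions are therefore stated over
   bare types, using only Stdlib.

   AD contradicts constructive_indefinite_description: under that axiom any
   statement that assumes AD holds vacuously. *)
From Stdlib Require Import Reals List.

Set Implicit Arguments.

Record Topology (X : Type) : Type := {
  is_open :> (X -> Prop) -> Prop;
  open_full : is_open (fun _ => True);
  open_inter : forall U V, is_open U -> is_open V ->
    is_open (fun x => U x /\ V x);
  open_union : forall F : (X -> Prop) -> Prop, (forall U, F U -> is_open U) ->
    is_open (fun x => exists U, F U /\ U x) }.

Definition is_closed (X : Type) (T : Topology X) (C : X -> Prop) : Prop :=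
  T (fun x => ~ C x).

Definition continuous (X Y : Type) (T : Topology X) (S : Topology Y)
    (f : X -> Y) : Prop :=
  forall U, S U -> T (fun x => U (f x)).

Definition subspace_topology (X : Type) (T : Topology X) (C : X -> Prop) :
  Topology {x : X | C x}.
Proof.
refine {| is_open := fun V : {x : X | C x} -> Prop =>
            exists U, T U /\ forall y, V y <-> U (proj1_sig y) |}.
- exists (fun _ => True); split; [apply open_full | tauto].
- intros V1 V2 [U1 [o1 e1]] [U2 [o2 e2]].
  exists (fun x => U1 x /\ U2 x); split; [now apply open_inter|].
  intro y; rewrite e1, e2; tauto.
- intros F hF.
  exists (fun x => exists U, (T U /\ exists V, F V /\
            forall y, V y <-> U (proj1_sig y)) /\ U x).
  split; [apply open_union; tauto|].
  intro y; split.
  + intros [V [FV Vy]]; destruct (hF V FV) as [U [oU e]].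
    exists U; split; [|now apply e].
    split; [exact oU | now exists V].
  + intros [U [[_ [V [FV e]]] Uy]]; exists V; split; [exact FV | now apply e].
Defined.

Definition countable (X : Type) (D : X -> Prop) : Prop :=
  exists f : X -> nat, forall x y, D x -> D y -> f x = f y -> x = y.

Definition separable (X : Type) (T : Topology X) : Prop :=
  exists D : X -> Prop, countable D /\
    forall U, T U -> (exists x, U x) -> exists x, D x /\ U x.

Definition is_metric (X : Type) (d : X -> X -> R) : Prop :=
  (forall x y, 0 <= d x y)%R /\
  (forall x y, d x y = 0%R <-> x = y) /\
  (forall x y, d x y = d y x) /\
  (forall x y z, d x z <= d x y + d y z)%R.

Definition metric_open (X : Type) (d : X -> X -> R) (U : X -> Prop) : Prop :=
  forall x, U x -> exists e, (0 < e)%R /\ forall y, (d x y < e)%R -> U y.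

Definition complete_metric (X : Type) (d : X -> X -> R) : Prop :=
  forall u : nat -> X,
    (forall e, (0 < e)%R -> exists n0, forall n m, n0 <= n -> n0 <= m ->
       (d (u n) (u m) < e)%R) ->
    exists l, forall e, (0 < e)%R -> exists n0, forall n, n0 <= n ->
       (d (u n) l < e)%R.

Definition completely_metrizable (X : Type) (T : Topology X) : Prop :=
  exists d : X -> X -> R, is_metric d /\ complete_metric d /\
    forall U, T U <-> metric_open d U.

Definition polish (X : Type) (T : Topology X) : Prop :=
  separable T /\ completely_metrizable T.

Definition zero_dimensional (X : Type) (T : Topology X) : Prop :=
  forall (x : X) (U : X -> Prop), T U -> U x ->
    exists V, T V /\ is_closed T V /\ V x /\ forall y, V y -> U y.

Definition Baire : Type := nat -> nat.

Definition Baire_topology : Topology Baire.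
Proof.
refine {| is_open := fun U : Baire -> Prop => forall x, U x ->
            exists n, forall y : Baire, (forall k, k < n -> y k = x k) -> U y |}.
- intros; now exists 0.
- intros U V oU oV x [Ux Vx].
  destruct (oU x Ux) as [n hn], (oV x Vx) as [m hm].
  exists (n + m); intros y hy; split; [apply hn | apply hm];
    intros k hk; apply hy.
  + now apply Nat.lt_lt_add_r.
  + now apply Nat.lt_lt_add_l.
- intros F hF x [U [FU Ux]]; destruct (hF U FU x Ux) as [n hn].
  exists n; intros y hy; exists U; auto.
Defined.

Definition FN : Type := {Y : Baire -> Prop | is_closed Baire_topology Y}.

Definition FN_space (Y : FN) : Type := {x : Baire | proj1_sig Y x}.

Definition FN_topology (Y : FN) : Topology (FN_space Y) :=
  subspace_topology Baire_topology (proj1_sig Y).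

Definition sigma_algebra (X : Type) (S : (X -> Prop) -> Prop) : Prop :=
  S (fun _ => False) /\
  (forall A, S A -> S (fun x => ~ A x)) /\
  (forall A : nat -> X -> Prop, (forall n, S (A n)) ->
     S (fun x => exists n, A n x)).

Definition effros_borel (B : FN -> Prop) : Prop :=
  forall S : (FN -> Prop) -> Prop, sigma_algebra S ->
    (forall U : Baire -> Prop, Baire_topology U ->
       S (fun Y => exists x, proj1_sig Y x /\ U x)) ->
    S B.

Definition wadge_le (Z : Type) (T : Topology Z) (A B : Z -> Prop) : Prop :=
  exists f : Z -> Z, continuous T T f /\ forall x, B (f x) <-> A x.

Definition wadge_equiv (Z : Type) (T : Topology Z) (A B : Z -> Prop) : Prop :=
  wadge_le T A B /\ wadge_le T B A.

Definition wadge_hierarchy (Z : Type) (T : Topology Z) : Type :=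
  {C : (Z -> Prop) -> Prop |
     exists A, forall B, C B <-> wadge_equiv T A B}.

Definition wadge_hierarchy_le (Z : Type) (T : Topology Z)
    (C D : wadge_hierarchy T) : Prop :=
  exists A B, proj1_sig C A /\ proj1_sig D B /\ wadge_le T A B.

Definition order_isomorphic (P Q : Type) (leP : P -> P -> Prop)
    (leQ : Q -> Q -> Prop) : Prop :=
  exists (f : P -> Q) (g : Q -> P),
    (forall p, g (f p) = p) /\ (forall q, f (g q) = q) /\
    (forall p p', leP p p' <-> leQ (f p) (f p')).

(* Dependent choices from a nonempty subset A of R reduce to this form: extend
   the relation by relating every point outside A to every point of A. *)
Definition DC_R : Prop :=
  forall P : R -> R -> Prop, (forall x, exists y, P x y) ->
    exists u : nat -> R, forall n, P (u n) (u (S n)).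

(* A strategy maps the current position, a finite sequence of moves, to the
   next move; player I plays x 0, x 2, ..., player II plays x 1, x 3, ..., and
   I wins iff x is in the payoff set. *)
Definition position (x : Baire) (n : nat) : list nat := map x (seq 0 n).

Definition I_wins (A : Baire -> Prop) : Prop :=
  exists s : list nat -> nat, forall x : Baire,
    (forall n, x (2 * n) = s (position x (2 * n))) -> A x.

Definition II_wins (A : Baire -> Prop) : Prop :=
  exists s : list nat -> nat, forall x : Baire,
    (forall n, x (2 * n + 1) = s (position x (2 * n + 1))) -> ~ A x.

Definition AD : Prop := forall A : Baire -> Prop, I_wins A \/ II_wins A.

(* Main.v *)
(* Let [N] be the Baire space and let [F] be a closed copy of [X] in [N].  To a
   tree coded by [c] attach a closed set [attach F c]: the disjoint sum of [F]
   and of the space whose points are the pairs (branch of the tree, element of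
   [N]) together with isolated points for the nodes.  If the tree is well
   founded, this is [F] plus a discrete space, which has the same Wadge hierarchy
   as [F]; otherwise it contains a closed copy of [N], so it and [N] are retracts
   of each other, whence its Wadge hierarchy is that of [N].  If the hierarchies
   of [X] and [N] differ, the well-founded trees are thus the preimage of the set
   in question.  If they agree, take the empty set for [F] instead: the
   hierarchy is then that of [N] for ill-founded trees and that of a discrete
   space for well-founded ones.  In both cases the set is not Borel, because the
   preimage of a Borel set is analytic and coanalytic while the set of
   well-founded trees is not analytic. *)
From Stdlib Require Import Reals List Arith Lia Lra Cantor.
From Stdlib Require Import Classical ClassicalDescription.
From Stdlib Require Import FunctionalExtensionality PropExtensionality.
Require Import Defs.
Import ListNotations.

(** * Countable choice for sequences *)

Lemma exists_least (P : nat -> Prop) :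
  (exists n, P n) -> exists! n, P n /\ forall m, P m -> n <= m.
Proof.
intro h; apply dec_inh_nat_subset_has_unique_least_element; [|exact h].
intro n; apply classic.
Qed.

(** Definite description selects only uniquely determined numbers, so it gives no choice function on
    sets of reals. The default value is 0. *)
Definition the_nat (P : nat -> Prop) : nat :=
  match excluded_middle_informative (exists! n, P n) with
  | left h => proj1_sig (constructive_definite_description P h)
  | right _ => 0
  end.

Lemma the_nat_eq (P : nat -> Prop) n :
  P n -> (forall m, P m -> m = n) -> the_nat P = n.
Proof.
intros Pn un; unfold the_nat.
destruct (excluded_middle_informative _) as [h|h].
- destruct (constructive_definite_description P h) as [m Pm]; auto.
- destruct h; exists n; split; [exact Pn|]; intros m Pm; symmetry; auto.
Qed.

Definition least (P : nat -> Prop) : nat :=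
  the_nat (fun n => P n /\ forall m, P m -> n <= m).

Lemma least_spec (P : nat -> Prop) :
  (exists n, P n) -> P (least P) /\ forall m, P m -> least P <= m.
Proof.
intro h; destruct (exists_least P h) as [n [[Pn ln] un]].
unfold least; rewrite (the_nat_eq _ n); [now split| now split|].
intros m hm; symmetry; auto.
Qed.

(** Truth is 0 because in every code below a zero entry means membership. *)
Definition truth (P : Prop) : nat :=
  if excluded_middle_informative P then 0 else 1.

Lemma truth_eq0 (P : Prop) : truth P = 0 <-> P.
Proof.
unfold truth; destruct (excluded_middle_informative P); split; auto.
- discriminate.
- tauto.
Qed.

Lemma truth_le1 (P : Prop) : truth P <= 1.
Proof. unfold truth; destruct (excluded_middle_informative P); lia. Qed.

(** This is the integer part of $3^n r$ for the real $r=\sum_k b_k 3^{-k-1}$ with digits $b_k\le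
    1$. *)
Fixpoint ternary (b : nat -> nat) (n : nat) : nat :=
  match n with 0 => 0 | S n => 3 * ternary b n + b n end.

(** Nested intervals: with digits at most 1 the tail after $n$ digits contributes at most $1/2$ to
    $3^n r$. As $1/2<1$, rounding down recovers the digits without ambiguity. *)
Lemma ternary_real (b : nat -> nat) : (forall n, b n <= 1) ->
  exists r : R, forall n, (INR (ternary b n) <= 3 ^ n * r <= INR (ternary b n) + / 2)%R.
Proof.
intro hb.
pose (lo := fun n => (INR (ternary b n) / 3 ^ n)%R).
pose (hi := fun n => ((INR (ternary b n) + / 2) / 3 ^ n)%R).
assert (p3 : forall n, (0 < 3 ^ n)%R) by (intro; apply pow_lt; lra).
assert (bb : forall n, (0 <= INR (b n) <= 1)%R).
{ intro n; split; [apply pos_INR|]; apply (le_INR _ 1), hb. }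
assert (step : forall n, (INR (ternary b (S n)) = 3 * INR (ternary b n) + INR (b n))%R).
{ intro n; cbn [ternary]; rewrite plus_INR, mult_INR; simpl; lra. }
assert (lo_S : forall n, (lo n <= lo (S n))%R).
{ intro n; unfold lo; rewrite step; simpl pow.
  replace (INR (ternary b n) / 3 ^ n)%R
    with ((3 * INR (ternary b n)) / (3 * 3 ^ n))%R by (field; apply Rgt_not_eq, p3).
  apply Rmult_le_compat_r; [|destruct (bb n); lra].
  left; apply Rinv_0_lt_compat; specialize (p3 n); lra. }
assert (hi_S : forall n, (hi (S n) <= hi n)%R).
{ intro n; unfold hi; rewrite step; simpl pow.
  replace ((INR (ternary b n) + / 2) / 3 ^ n)%R
    with ((3 * INR (ternary b n) + 3 / 2) / (3 * 3 ^ n))%R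
    by (field; apply Rgt_not_eq, p3).
  apply Rmult_le_compat_r; [|destruct (bb n); lra].
  left; apply Rinv_0_lt_compat; specialize (p3 n); lra. }
assert (lo_mono : forall n m, n <= m -> (lo n <= lo m)%R).
{ intros n m h; induction h; [lra|]; specialize (lo_S m); lra. }
assert (hi_mono : forall n m, n <= m -> (hi m <= hi n)%R).
{ intros n m h; induction h; [lra|]; specialize (hi_S m); lra. }
assert (lo_hi : forall n, (lo n <= hi n)%R).
{ intro n; apply Rmult_le_compat_r; [|lra].
  left; now apply Rinv_0_lt_compat. }
assert (cross : forall n m, (lo n <= hi m)%R).
{ intros n m; specialize (lo_mono n (max n m) ltac:(lia)).
  specialize (hi_mono m (max n m) ltac:(lia)).
  specialize (lo_hi (max n m)); lra. }
destruct (completeness (fun x => exists n, x = lo n)) as [r [ub lub]].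
- exists (hi 0); intros x [n ->]; apply cross.
- exists (lo 0), 0; reflexivity.
- exists r; intro n.
  assert (h1 : (lo n <= r)%R) by (apply ub; now exists n).
  assert (h2 : (r <= hi n)%R) by (apply lub; intros x [m ->]; apply cross).
  split.
  + replace (INR (ternary b n)) with (3 ^ n * lo n)%R
      by (unfold lo; field; apply Rgt_not_eq, p3).
    apply Rmult_le_compat_l; [left; apply p3 | exact h1].
  + replace (INR (ternary b n) + / 2)%R with (3 ^ n * hi n)%R
      by (unfold hi; field; apply Rgt_not_eq, p3).
    apply Rmult_le_compat_l; [left; apply p3 | exact h2].
Qed.

(** The graph of a sequence, a set of coded pairs, is stored in the ternary digits of a real. *)
Lemma R_onto_Baire : exists g : R -> Baire, forall x, exists r, g r = x.
Proof.
pose (fl := fun (r : R) n =>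
  the_nat (fun m => (INR m <= 3 ^ n * r < INR m + 1)%R)).
(* The equation says that the digit at the code of $(n,m)$ is 0, that is, that $(n,m)$ lies in the
   graph. *)
exists (fun r n => the_nat (fun m =>
  fl r (S (to_nat (n, m))) = 3 * fl r (to_nat (n, m)))).
intro x.
pose (b := fun k => truth (x (fst (of_nat k)) = snd (of_nat k))).
destruct (ternary_real b) as [r hr]; [intro; apply truth_le1|].
assert (flE : forall n, fl r n = ternary b n).
{ intro n; apply the_nat_eq.
  - specialize (hr n); lra.
  - intros m hm; specialize (hr n).
    assert (h1 : (INR m < INR (S (ternary b n)))%R) by (rewrite S_INR; lra).
    assert (h2 : (INR (ternary b n) < INR (S m))%R) by (rewrite S_INR; lra).
    apply INR_lt in h1, h2; lia. }
exists r; apply functional_extensionality; intro n; apply the_nat_eq.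
- rewrite !flE; cbn [ternary].
  replace (b _) with 0; [lia|]; symmetry; apply truth_eq0.
  now rewrite cancel_of_to.
- intros m; rewrite !flE; cbn [ternary]; intro e.
  assert (h : b (to_nat (n, m)) = 0) by lia.
  unfold b in h; rewrite truth_eq0, cancel_of_to in h; now symmetry.
Qed.

Definition countable_choice : Prop := forall P : nat -> Baire -> Prop,
  (forall n, exists x, P n x) -> exists u : nat -> Baire, forall n, P n (u n).

(** Along a chain of dependent choices, entry 0 is a counter and the remaining entries solve the
    instance named by the previous counter. *)
Lemma DC_R_countable_choice : DC_R -> countable_choice.
Proof.
intros dc P hP; destruct R_onto_Baire as [g hg].
destruct (dc (fun r s => g s 0 = S (g r 0) /\
                         P (g r 0) (fun k => g s (S k)))) as [u hu].
{ intro r; destruct (hP (g r 0)) as [x hx].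
  destruct (hg (fun k => match k with 0 => S (g r 0) | S k => x k end))
    as [s hs].
  exists s; rewrite hs; split; [reflexivity | exact hx]. }
set (m := g (u 0) 0).
assert (hm : forall n, g (u n) 0 = m + n).
{ induction n as [|n IH]; [unfold m; lia|].
  rewrite (proj1 (hu n)), IH; lia. }
(* The chain starts at an uncontrolled counter value [m]; the instances below [m] require only
   finitely many choices. *)
assert (fin : forall j, exists v : nat -> Baire, forall n, n < j -> P n (v n)).
{ induction j as [|j [v hv]]; [exists (fun _ => fun _ => 0); lia|].
  destruct (hP j) as [x hx].
  exists (fun n => if n <? j then v n else x); intros n hn.
  destruct (Nat.ltb_spec n j); [now apply hv|].
  now replace n with j by lia. }
destruct (fin m) as [v hv].
exists (fun n => if n <? m then v n else fun k => g (u (S (n - m))) (S k)).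
intro n; destruct (Nat.ltb_spec n m); [now apply hv|].
replace n with (g (u (n - m)) 0) at 1 by (rewrite hm; lia).
apply hu.
Qed.

(** * Analytic sets *)

Definition agree (n : nat) (x y : Baire) : Prop := forall k, k < n -> y k = x k.

Lemma agree_refl n x : agree n x x.
Proof. now intros k _. Qed.

Lemma agree_le n m x y : n <= m -> agree m x y -> agree n x y.
Proof. intros nm h k hk; apply h; lia. Qed.

Lemma agree_sym n x y : agree n x y -> agree n y x.
Proof. intros h k hk; symmetry; auto. Qed.

Lemma agree_trans n x y z : agree n x y -> agree n y z -> agree n x z.
Proof. intros h1 h2 k hk; rewrite h2; auto. Qed.

Lemma position_S x n : position x (S n) = position x n ++ [x n].
Proof. unfold position; now rewrite seq_S, map_app. Qed.

Lemma position_length x n : length (position x n) = n.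
Proof. unfold position; now rewrite length_map, length_seq. Qed.

Lemma position_agree n x y : position x n = position y n <-> agree n x y.
Proof.
induction n as [|n IH].
- split; [intros _ k hk; lia | reflexivity].
- rewrite !position_S; split.
  + intro e; apply app_inj_tail in e; destruct e as [e1 e2].
    intros k hk; destruct (Nat.eq_dec k n) as [->|]; [now symmetry|].
    apply (proj1 IH e1); lia.
  + intro h; rewrite (h n) by lia; f_equal; apply IH.
    apply (agree_le _ _ _ _ (Nat.le_succ_diag_r n) h).
Qed.

Fixpoint list_code (s : list nat) : nat :=
  match s with [] => 0 | a :: s => S (to_nat (a, list_code s)) end.

Lemma list_code_inj s t : list_code s = list_code t -> s = t.
Proof.
revert t; induction s as [|a s IH]; intros [|b t]; cbn [list_code];
  try discriminate; [reflexivity|].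
intro e; apply eq_add_S, to_nat_inj in e; injection e as -> e.
now rewrite (IH t e).
Qed.

Definition code (s t : list nat) : nat := to_nat (list_code s, list_code t).

Lemma code_inj s t s' t' : code s t = code s' t' -> s = s' /\ t = t'.
Proof.
unfold code; intro e; apply to_nat_inj in e; injection e as e1 e2.
split; now apply list_code_inj.
Qed.

Lemma strict_bound (f : nat -> nat) n : exists m, forall k, k < n -> f k < m.
Proof.
induction n as [|n [m hm]]; [exists 0; lia|].
exists (S (max m (f n))); intros k hk.
destruct (Nat.eq_dec k n) as [->|]; [lia|]; specialize (hm k ltac:(lia)); lia.
Qed.

Definition closed2 (P : Baire -> Baire -> Prop) : Prop := forall x y, ~ P x y ->
  exists n, forall x' y', agree n x x' -> agree n y y' -> ~ P x' y'.

(* Every closed subset of the plane is a section of [universal]. *)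
Definition universal (e x y : Baire) : Prop :=
  forall n, e (code (position x (S n)) (position y (S n))) = 0.

Lemma universal_closed2 e : closed2 (universal e).
Proof.
intros x y h; apply not_all_ex_not in h; destruct h as [n h].
exists (S n); intros x' y' hx hy hu; apply h.
rewrite (proj2 (position_agree _ _ _) hx), (proj2 (position_agree _ _ _) hy).
apply hu.
Qed.

(** The code marks with 0 the pairs of prefixes of points of [P]; a point all of whose prefixes are
    marked is a limit of points of [P]. *)
Lemma closed2_universal (P : Baire -> Baire -> Prop) : closed2 P ->
  exists e, forall x y, P x y <-> universal e x y.
Proof.
intro cl.
exists (fun k => truth (exists x y n, P x y /\
                    code (position x (S n)) (position y (S n)) = k)).
intros x y; split.
- intros Pxy n; apply truth_eq0; now exists x, y, n.
- intro hu; apply NNPP; intro nP; destruct (cl x y nP) as [n hn].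
  specialize (hu n); cbv beta in hu; rewrite truth_eq0 in hu.
  destruct hu as [x' [y' [m [P' e]]]].
  apply code_inj in e; destruct e as [ex ey].
  assert (mn : m = n).
  { apply (f_equal (@length nat)) in ex; rewrite !position_length in ex; lia. }
  subst m; apply position_agree, agree_sym in ex, ey.
  apply (hn x' y'); try exact P';
    eapply agree_le; try eassumption; lia.
Qed.

(** The witness is a sequence rather than a closed set, so that [countable_choice] can select codes
    for countably many analytic sets. *)
Definition analytic (A : Baire -> Prop) : Prop :=
  exists e, forall x, A x <-> exists y, universal e x y.

Lemma analytic_projection (P : Baire -> Baire -> Prop) (A : Baire -> Prop) :
  closed2 P -> (forall x, A x <-> exists y, P x y) -> analytic A.
Proof.
intros cl hA; destruct (closed2_universal P cl) as [e he]; exists e.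
intro x; rewrite hA; split; intros [y hy]; exists y; now apply he.
Qed.

Lemma analytic_closed (A : Baire -> Prop) :
  is_closed Baire_topology A -> analytic A.
Proof.
intro cl; apply (analytic_projection (fun x _ => A x)).
- intros x y nA; destruct (cl x nA) as [n hn]; exists n; intros; auto.
- intro x; split; [intro; now exists x | now intros [_ h]].
Qed.

(** The witness names in [y 0] the length of a prefix of [x] whose ball lies in [A]; this condition
    depends on finitely many entries only. *)
Lemma analytic_open (A : Baire -> Prop) : Baire_topology A -> analytic A.
Proof.
intro op.
apply (analytic_projection (fun x y => forall x', agree (y 0) x x' -> A x')).
- intros x y h; exists (S (y 0)); intros x' y' hx hy h'; apply h.
  rewrite (hy 0) in h' by lia.
  intros z hz; apply h'.
  apply agree_trans with x; [|exact hz].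
  apply agree_sym; apply (agree_le _ (S (y 0))); [lia | exact hx].
- intro x; split.
  + intro Ax; destruct (op x Ax) as [n hn]; exists (fun _ => n); auto.
  + intros [y hy]; apply hy, agree_refl.
Qed.

Definition shift (x : Baire) : Baire := fun k => x (S k).
Definition prepend (a : nat) (x : Baire) : Baire :=
  fun k => match k with 0 => a | S k => x k end.
Definition row (y : Baire) (n : nat) : Baire := fun k => y (to_nat (n, k)).

Lemma shift_agree n x y : agree (S n) x y -> agree n (shift x) (shift y).
Proof. intros h k hk; apply h; lia. Qed.

(** The first entry of the witness names the set, and the rest is a witness for it. *)
Lemma analytic_union (cc : countable_choice) (A : nat -> Baire -> Prop) :
  (forall n, analytic (A n)) -> analytic (fun x => exists n, A n x).
Proof.
intro hA; destruct (cc _ hA) as [e he].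
apply (analytic_projection (fun x y => universal (e (y 0)) x (shift y))).
- intros x y h; destruct (universal_closed2 _ _ _ h) as [n hn].
  exists (S n); intros x' y' hx hy; rewrite (hy 0) by lia.
  apply hn; [apply (agree_le n (S n)); [lia | exact hx] | now apply shift_agree].
- intro x; split.
  + intros [n An]; apply he in An; destruct An as [y hy].
    now exists (prepend n y).
  + intros [y hy]; exists (y 0); apply he; now exists (shift y).
Qed.

(** One sequence holds a witness for each set as its rows. Choice is used twice: for the codes, and
    for the witnesses at a given point. *)
Lemma analytic_intersection (cc : countable_choice) (A : nat -> Baire -> Prop) :
  (forall n, analytic (A n)) -> analytic (fun x => forall n, A n x).
Proof.
intro hA; destruct (cc _ hA) as [e he].
apply (analytic_projection (fun x y => forall n, universal (e n) x (row y n))).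
- intros x y h; apply not_all_ex_not in h; destruct h as [n h].
  destruct (universal_closed2 _ _ _ h) as [m hm].
  destruct (strict_bound (fun k => to_nat (n, k)) m) as [M hM].
  exists (max m M); intros x' y' hx hy h'.
  apply (hm x' (row y' n)); [..|apply h'].
  + apply (agree_le m (max m M)); [lia | exact hx].
  + intros k hk; apply hy; specialize (hM k hk); lia.
- intro x; split.
  + intro hx; destruct (cc (fun n y => universal (e n) x y)) as [u hu].
    { intro n; apply he, hx. }
    exists (fun k => u (fst (of_nat k)) (snd (of_nat k))); intro n.
    replace (row _ n) with (u n); [apply hu|].
    apply functional_extensionality; intro k; unfold row.
    now rewrite cancel_of_to.
  + intros [y hy] n; apply he; now exists (row y n).
Qed.

Lemma analytic_ext (A B : Baire -> Prop) :
  (forall x, A x <-> B x) -> analytic A -> analytic B.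
Proof. intros h [e he]; exists e; intro x; rewrite <- h; apply he. Qed.

(** The tree of [c] searches for a witness [b] that [c] belongs to the analytic set coded by [c]
    itself, so non-analyticity of the well-founded trees is a plain diagonal argument. *)
Definition ill_founded (c : Baire) : Prop := exists b, universal c c b.

Lemma well_founded_not_analytic : ~ analytic (fun c => ~ ill_founded c).
Proof. intros [e he]; specialize (he e); unfold ill_founded in he; tauto. Qed.

(** The sets whose preimage and its complement are both analytic form a sigma-algebra; by [hY] it
    contains the Effros generators, whose preimages are open. *)
Lemma effros_borel_bianalytic (cc : countable_choice) (Y : Baire -> FN)
    (hY : forall U, Baire_topology U ->
       Baire_topology (fun c => exists x, proj1_sig (Y c) x /\ U x))
    (B : FN -> Prop) :
  effros_borel B ->
  analytic (fun c => B (Y c)) /\ analytic (fun c => ~ B (Y c)).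
Proof.
intro hB.
apply (hB (fun C => analytic (fun c => C (Y c)) /\ analytic (fun c => ~ C (Y c)))).
- split; [|split].
  + split; apply analytic_open; [intros x [] | intros x _; exists 0; tauto].
  + intros C [h1 h2]; split; [exact h2|].
    apply (analytic_ext (fun c => C (Y c))); [|exact h1].
    intro x; split; [tauto | apply NNPP].
  + intros C hC; split.
    * apply (analytic_union cc (fun n c => C n (Y c))); apply hC.
    * apply (analytic_ext (fun c => forall n, ~ C n (Y c))).
      { intro x; split; [intros h [n hn]; exact (h n hn) | intros h n hn; eauto]. }
      apply (analytic_intersection cc (fun n c => ~ C n (Y c))); apply hC.
- intros U oU; split.
  + apply analytic_open, hY, oU.
  + apply analytic_closed; unfold is_closed.
    intros c h; apply NNPP in h; destruct (hY U oU c h) as [n hn].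
    exists n; intros y hy ny; apply ny; exact (hn y hy).
Qed.

(** * Wadge hierarchies and retracts *)

Set Implicit Arguments.

Lemma pred_ext (X : Type) (U V : X -> Prop) : (forall x, U x <-> V x) -> U = V.
Proof.
intro h; apply functional_extensionality; intro x.
apply propositional_extensionality, h.
Qed.

Lemma open_local (X : Type) (T : Topology X) (U : X -> Prop) :
  (forall x, U x -> exists W, T W /\ W x /\ forall y, W y -> U y) -> T U.
Proof.
intro h.
replace U with
  (fun x => exists W, (T W /\ forall y, W y -> U y) /\ W x).
- apply open_union; tauto.
- apply pred_ext; intro x; split.
  + intros [W [[_ sub] Wx]]; auto.
  + intro Ux; destruct (h x Ux) as [W hW]; exists W; tauto.
Qed.

Lemma continuous_id (X : Type) (T : Topology X) : continuous T T (fun x => x).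
Proof. now intros U oU. Qed.

Lemma continuous_comp (X Y Z : Type) (T : Topology X) (S : Topology Y)
    (Q : Topology Z) (f : X -> Y) (g : Y -> Z) :
  continuous T S f -> continuous S Q g -> continuous T Q (fun x => g (f x)).
Proof. intros hf hg U oU; apply (hf _ (hg U oU)). Qed.

(** Wadge reducibility between subsets of two different spaces; on a single space it unfolds to
    [wadge_le]. *)
Definition reduces (X Y : Type) (T : Topology X) (S : Topology Y)
    (A : X -> Prop) (B : Y -> Prop) : Prop :=
  exists f : X -> Y, continuous T S f /\ forall x, B (f x) <-> A x.

Lemma reduces_trans (X Y Z : Type) (T : Topology X) (S : Topology Y)
    (Q : Topology Z) A B C :
  reduces T S A B -> reduces S Q B C -> reduces T Q A C.
Proof.
intros [f [cf hf]] [g [cg hg]]; exists (fun x => g (f x)); split.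
- eapply continuous_comp; eassumption.
- intro x; now rewrite hg.
Qed.

Lemma reduces_refl (X : Type) (T : Topology X) A : reduces T T A A.
Proof. exists (fun x => x); split; [apply continuous_id | tauto]. Qed.

Definition equireducible (X Y : Type) (T : Topology X) (S : Topology Y)
    (A : X -> Prop) (B : Y -> Prop) : Prop :=
  reduces T S A B /\ reduces S T B A.

Lemma equireducible_refl (X : Type) (T : Topology X) A : equireducible T T A A.
Proof. split; apply reduces_refl. Qed.

Lemma equireducible_sym (X Y : Type) (T : Topology X) (S : Topology Y) A B :
  equireducible T S A B -> equireducible S T B A.
Proof. unfold equireducible; tauto. Qed.

Lemma equireducible_trans (X Y Z : Type) (T : Topology X) (S : Topology Y)
    (Q : Topology Z) A B C :
  equireducible T S A B -> equireducible S Q B C -> equireducible T Q A C.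
Proof.
intros [h1 h2] [h3 h4]; split; eapply reduces_trans; eassumption.
Qed.

Definition represented (X Y : Type) (T : Topology X) (S : Topology Y) : Prop :=
  forall A : X -> Prop, exists B : Y -> Prop, equireducible T S A B.

Section Transfer.
Variables (X Y : Type) (T : Topology X) (S : Topology Y).
Hypothesis rep : represented T S.

(** Collecting all sets equireducible with a member of the class avoids choosing representatives. *)
Definition transfer (C : wadge_hierarchy T) : wadge_hierarchy S.
Proof.
exists (fun B => exists A, proj1_sig C A /\ equireducible T S A B).
destruct C as [C [A0 hA]]; destruct (rep A0) as [B0 hB]; exists B0; intro B.
simpl; split.
- intros [A [CA AB]]; apply hA in CA; change (equireducible S S B0 B).
  apply equireducible_trans with (S := T) (B := A0); [now apply equireducible_sym|].
  now apply equireducible_trans with (S := T) (B := A).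
- intro h; exists A0; split; [apply hA, equireducible_refl|].
  now apply equireducible_trans with (S := S) (B := B0).
Defined.
End Transfer.

Lemma wadge_class_eq (X : Type) (T : Topology X) (C D : wadge_hierarchy T) :
  (forall A, proj1_sig C A <-> proj1_sig D A) -> C = D.
Proof.
destruct C as [C hC], D as [D hD]; simpl; intro h.
apply pred_ext in h; subst D; f_equal; apply proof_irrelevance.
Qed.

Lemma wadge_class_equireducible (X : Type) (T : Topology X)
    (C : wadge_hierarchy T) A :
  proj1_sig C A -> forall B, proj1_sig C B <-> equireducible T T A B.
Proof.
destruct C as [C [A0 hC]]; simpl; intros CA B; apply hC in CA; rewrite hC.
split; intro h.
- apply equireducible_trans with (S := T) (B := A0);
    [now apply equireducible_sym | exact h].
- now apply equireducible_trans with (S := T) (B := A).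
Qed.

Lemma transfer_inverse (X Y : Type) (T : Topology X) (S : Topology Y)
    (r : represented T S) (r' : represented S T) (C : wadge_hierarchy T) :
  transfer r' (transfer r C) = C.
Proof.
apply wadge_class_eq; intro A; simpl; split.
- intros [B [[A' [CA' h]] h']].
  apply (wadge_class_equireducible _ _ CA').
  now apply equireducible_trans with (S := S) (B := B).
- intro CA; destruct (r A) as [B hB]; exists B.
  split; [now exists A | now apply equireducible_sym].
Qed.

Definition same_hierarchy (X Y : Type) (T : Topology X) (S : Topology Y) : Prop :=
  order_isomorphic (@wadge_hierarchy_le X T) (@wadge_hierarchy_le Y S).

Lemma represented_same_hierarchy (X Y : Type) (T : Topology X) (S : Topology Y) :
  represented T S -> represented S T -> same_hierarchy T S.
Proof.
intros r r'; exists (transfer r), (transfer r').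
split; [|split]; try (intro; apply transfer_inverse).
intros C D; split.
- intros [A [B [CA [DB AB]]]].
  destruct (r A) as [A' hA], (r B) as [B' hB].
  exists A', B'; split; [now exists A|]; split; [now exists B|].
  apply reduces_trans with (S := T) (B := A); [apply hA|].
  apply reduces_trans with (S := T) (B := B); [exact AB | apply hB].
- intros [A' [B' [[A [CA hA]] [[B [DB hB]] AB]]]].
  exists A, B; split; [exact CA|]; split; [exact DB|].
  apply reduces_trans with (S := S) (B := A'); [apply hA|].
  apply reduces_trans with (S := S) (B := B'); [exact AB | apply hB].
Qed.

Lemma same_hierarchy_sym (X Y : Type) (T : Topology X) (S : Topology Y) :
  same_hierarchy T S -> same_hierarchy S T.
Proof.
intros [f [g [gf [fg h]]]]; exists g, f; split; [exact fg|]; split; [exact gf|].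
intros p p'; now rewrite h, !fg.
Qed.

Lemma same_hierarchy_trans (X Y Z : Type) (T : Topology X) (S : Topology Y)
    (Q : Topology Z) :
  same_hierarchy T S -> same_hierarchy S Q -> same_hierarchy T Q.
Proof.
intros [f [g [gf [fg h]]]] [f' [g' [gf' [fg' h']]]].
exists (fun p => f' (f p)), (fun q => g (g' q)); split; [|split].
- intro p; now rewrite gf', gf.
- intro q; now rewrite fg, fg'.
- intros p p'; now rewrite h, h'.
Qed.

Definition retract (X Y : Type) (T : Topology X) (S : Topology Y) : Prop :=
  exists (i : X -> Y) (r : Y -> X),
    continuous T S i /\ continuous S T r /\ forall x, r (i x) = x.

(** A set is equireducible with its preimage under the retraction. Hence spaces that are retracts of
    each other share their hierarchy. *)
Lemma retract_represented (X Y : Type) (T : Topology X) (S : Topology Y) :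
  retract T S -> represented T S.
Proof.
intros [i [r [ci [cr ri]]]] A; exists (fun y => A (r y)); split.
- exists i; split; [exact ci|]; intro x; now rewrite ri.
- exists r; split; [exact cr | tauto].
Qed.

Lemma homeomorphic_same_hierarchy (X Y : Type) (T : Topology X) (S : Topology Y)
    (i : X -> Y) (r : Y -> X) :
  continuous T S i -> continuous S T r -> (forall x, r (i x) = x) ->
  (forall y, i (r y) = y) -> same_hierarchy T S.
Proof.
intros ci cr ri ir; apply represented_same_hierarchy; apply retract_represented.
- now exists i, r.
- now exists r, i.
Qed.

(** A clopen set reduces to any nontrivial set by a map with at most two values, one inside the
    target and one outside. *)
Lemma clopen_equireducible (X Y : Type) (T : Topology X) (S : Topology Y)
    (A : X -> Prop) (B : Y -> Prop) :
  T A -> is_closed T A -> S B -> is_closed S B ->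
  (exists x, A x) -> (exists x, ~ A x) -> (exists y, B y) -> (exists y, ~ B y) ->
  equireducible T S A B.
Proof.
assert (half : forall (X Y : Type) (T : Topology X) (S : Topology Y)
    (A : X -> Prop) (B : Y -> Prop), T A -> is_closed T A ->
    (exists y, B y) -> (exists y, ~ B y) -> reduces T S A B).
{ clear; intros X Y T S A B oA cA [p Bp] [q Bq].
  exists (fun x => if excluded_middle_informative (A x) then p else q); split.
  - intros U oU; apply open_local; intros x Ux.
    destruct (excluded_middle_informative (A x)) as [Ax|nAx].
    + exists A; split; [exact oA|]; split; [exact Ax|]; intros y Ay.
      now destruct (excluded_middle_informative (A y)).
    + exists (fun y => ~ A y); split; [exact cA|]; split; [exact nAx|].
      intros y nAy; now destruct (excluded_middle_informative (A y)).
  - intro x; now destruct (excluded_middle_informative (A x)). }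
intros; split; now apply half.
Qed.

(** * Zero-dimensional Polish spaces as closed subsets of the Baire space *)

Lemma FN_open (Y : FN) (V : FN_space Y -> Prop) :
  FN_topology Y V <->
  forall y, V y -> exists n, forall y', agree n (proj1_sig y) (proj1_sig y') -> V y'.
Proof.
split.
- intros [U [oU e]] y Vy; apply e in Vy; destruct (oU _ Vy) as [n hn].
  exists n; intros y' h; apply e, hn, h.
- intro h.
  exists (fun x => exists y n, V y /\ agree n (proj1_sig y) x /\
            forall y', agree n (proj1_sig y) (proj1_sig y') -> V y').
  split.
  + intros x [y [n [Vy [yx hn]]]]; exists n; intros x' xx'.
    exists y, n; split; [exact Vy|]; split; [|exact hn].
    now apply agree_trans with x.
  + intro y; split.
    * intro Vy; destruct (h y Vy) as [n hn]; exists y, n.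
      split; [exact Vy|]; split; [apply agree_refl | exact hn].
    * intros [y0 [n [_ [a hn]]]]; now apply hn.
Qed.

Lemma FN_open_ball (Y : FN) n (x : Baire) :
  FN_topology Y (fun y => agree n x (proj1_sig y)).
Proof.
apply FN_open; intros y hy; exists n; intros y' h.
now apply agree_trans with (proj1_sig y).
Qed.

Lemma FN_continuous (Y Z : FN) (f : FN_space Y -> FN_space Z) :
  (forall y n, exists m, forall y', agree m (proj1_sig y) (proj1_sig y') ->
     agree n (proj1_sig (f y)) (proj1_sig (f y'))) ->
  continuous (FN_topology Y) (FN_topology Z) f.
Proof.
intros h V oV; apply FN_open; intros y Vy.
rewrite FN_open in oV; destruct (oV _ Vy) as [n hn].
destruct (h y n) as [m hm]; exists m; auto.
Qed.

Lemma limit_unique_agree (x y : Baire) : (forall n, agree n x y) -> x = y.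
Proof.
intro h; apply functional_extensionality; intro k.
symmetry; apply (h (S k)); lia.
Qed.

Lemma FN_closed (Y : FN) (x : Baire) :
  (forall n, exists y, proj1_sig Y y /\ agree n x y) -> proj1_sig Y x.
Proof.
destruct Y as [Y cY]; simpl; intro h; apply NNPP; intro nY.
destruct (cY x nY) as [n hn]; destruct (h n) as [y [Yy a]].
exact (hn y a Yy).
Qed.

Section Embedding.
Variables (X : Type) (T : Topology X) (d : X -> X -> R).
Hypothesis dist : is_metric d.
Hypothesis complete : complete_metric d.
Hypothesis openE : forall U, T U <-> metric_open d U.
Variables (D : X -> Prop) (index : X -> nat).
Hypothesis index_inj : forall x y, D x -> D y -> index x = index y -> x = y.
Hypothesis dense : forall U, T U -> (exists x, U x) -> exists x, D x /\ U x.
Hypothesis zero : zero_dimensional T.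
Hypothesis cc : countable_choice.

Lemma radius_pos k : (0 < / INR (S k))%R.
Proof. apply Rinv_0_lt_compat, lt_0_INR; lia. Qed.

Lemma radius_small e : (0 < e)%R -> exists k, (/ INR (S k) < e)%R.
Proof.
intro he; destruct (archimed_cor1 e he) as [[|k] [hk pk]]; [lia|now exists k].
Qed.

Lemma ball_open x e : T (fun y => (d x y < e)%R).
Proof.
destruct dist as [_ [_ [_ tri]]]; apply openE; intros y hy.
exists (e - d x y)%R; split; [lra|]; intros z hz; specialize (tri x y z); lra.
Qed.

(** A countable base of balls with centres in [D], numbered by centre and radius; the set is empty
    if no point of [D] has the given index. *)
Definition basic (j : nat) (y : X) : Prop := exists x, D x /\
  index x = fst (of_nat j) /\ (d x y < / INR (S (snd (of_nat j))))%R.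

Lemma basic_base U [x] : T U -> U x ->
  exists j, basic j x /\ forall y, basic j y -> U y.
Proof.
destruct dist as [nn [_ [sym tri]]].
intros oU Ux; apply openE in oU; destruct (oU x Ux) as [e [he hU]].
destruct (@radius_small (e / 2)) as [k hk]; [lra|].
destruct (dense _ (ball_open x (/ INR (S k)))) as [p [Dp hp]].
{ exists x; replace (d x x) with 0%R; [apply radius_pos|].
  symmetry; now apply dist. }
exists (to_nat (index p, k)); unfold basic; rewrite cancel_of_to; simpl fst; simpl snd.
split.
- exists p; rewrite sym; tauto.
- intros y [q [Dq [e' hq]]]; apply index_inj in e'; [|assumption..]; subst q.
  apply hU; specialize (tri x p y); lra.
Qed.

(* Open sets are coded by sequences, so that countable choice for sequences
   selects countably many open sets. *)
Definition coded (b : Baire) (x : X) : Prop := exists j, b j = 0 /\ basic j x.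

Lemma open_coded U : T U -> exists b, coded b = U.
Proof.
intro oU; exists (fun j => truth (forall y, basic j y -> U y)).
apply pred_ext; intro x; split.
- intros [j [h bx]]; rewrite truth_eq0 in h; auto.
- intro Ux; destruct (basic_base _ oU Ux) as [j [bx hj]]; exists j.
  now rewrite truth_eq0.
Qed.

Definition small_clopen (k : nat) (V : X -> Prop) : Prop :=
  T V /\ is_closed T V /\ forall x y, V x -> V y -> (d x y <= / INR (S k))%R.

Lemma small_clopen_nbhd k x : exists V, small_clopen k V /\ V x.
Proof.
destruct dist as [nn [idd [sym tri]]].
destruct (zero x _ (ball_open x (/ INR (S k) / 2))) as [V [oV [cV [Vx hV]]]].
{ replace (d x x) with 0%R by (symmetry; now apply idd).
  pose proof (radius_pos k); lra. }
exists V; split; [split; [exact oV|]; split; [exact cV|]|exact Vx].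
intros y z Vy Vz; apply hV in Vy, Vz.
specialize (tri y x z); rewrite (sym y x) in tri; lra.
Qed.

(** For each pair $(k,j)$ a clopen set of diameter at most $1/(k+1)$ around the basic ball $j$ is
    chosen, if there is one. These sets cover because every point has a small clopen neighbourhood,
    and this contains a basic ball around the point. *)
Lemma small_clopen_covers : exists V : nat -> nat -> X -> Prop,
  (forall k j, small_clopen k (V k j)) /\ forall k x, exists j, V k j x.
Proof.
destruct (cc (fun i b => small_clopen (fst (of_nat i)) (coded b) /\
   ((exists V, small_clopen (fst (of_nat i)) V /\
               forall x, basic (snd (of_nat i)) x -> V x) ->
    forall x, basic (snd (of_nat i)) x -> coded b x))) as [u hu].
{ intro i; destruct (classic (exists V, small_clopen (fst (of_nat i)) V /\
               forall x, basic (snd (of_nat i)) x -> V x)) as [[V [sV hV]]|no].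
  - destruct (open_coded _ (proj1 sV)) as [b <-]; now exists b.
  (* If no suitable set exists, the constant sequence 1, which codes the empty set, is taken. *)
  - exists (fun _ => 1); split; [|tauto].
    replace (coded _) with (fun _ : X => False).
    + split; [|split; [|tauto]].
      * apply openE; intros x [].
      * apply openE; intros x _; exists 1%R; split; [lra|tauto].
    + apply pred_ext; intro x; split; [tauto|]; intros [j [h _]]; discriminate. }
exists (fun k j => coded (u (to_nat (k, j)))); split.
- intros k j; specialize (hu (to_nat (k, j))); rewrite cancel_of_to in hu; apply hu.
- intros k x; destruct (small_clopen_nbhd k x) as [V [sV Vx]].
  destruct (basic_base _ (proj1 sV) Vx) as [j [bx hj]]; exists j.
  specialize (hu (to_nat (k, j))); rewrite cancel_of_to in hu.
  apply hu; [now exists V | exact bx].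
Qed.

Lemma clopen_inter U V : T U /\ is_closed T U -> T V /\ is_closed T V ->
  T (fun x => U x /\ V x) /\ is_closed T (fun x => U x /\ V x).
Proof.
intros [oU cU] [oV cV]; split; [now apply open_inter|].
apply open_local; intros x h.
destruct (classic (U x)) as [Ux|nUx].
- exists (fun y => ~ V y); split; [exact cV|]; split; [tauto|]; tauto.
- exists (fun y => ~ U y); split; [exact cU|]; split; [tauto|]; tauto.
Qed.

Lemma clopen_compl U : T U /\ is_closed T U ->
  T (fun x => ~ U x) /\ is_closed T (fun x => ~ U x).
Proof.
intros [oU cU]; split; [exact cU|]; unfold is_closed.
replace (fun x => ~ ~ U x) with U; [exact oU|].
apply pred_ext; intro x; split; [tauto | apply NNPP].
Qed.

Lemma clopen_full : T (fun _ => True) /\ is_closed T (fun _ => True).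
Proof.
split; [apply open_full|]; apply openE; intros x h; tauto.
Qed.

Lemma clopen_all_lt (U : nat -> X -> Prop) n :
  (forall k, T (U k) /\ is_closed T (U k)) ->
  T (fun x => forall k, k < n -> U k x) /\
  is_closed T (fun x => forall k, k < n -> U k x).
Proof.
intro h; induction n as [|n IH].
- replace (fun x => forall k, k < 0 -> U k x) with (fun _ : X => True);
    [apply clopen_full|].
  apply pred_ext; intro x; split; [lia | tauto].
- replace (fun x => forall k, k < S n -> U k x)
    with (fun x => U n x /\ forall k, k < n -> U k x).
  + now apply clopen_inter.
  + apply pred_ext; intro x; split.
    * intros [h1 h2] k hk; destruct (Nat.eq_dec k n) as [->|]; [exact h1|].
      apply h2; lia.
    * intro h'; split; [apply h'; lia | intros; apply h'; lia].
Qed.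

(** A point is sent to the sequence of the least indices of the cover elements that contain it.
    Shrinking diameters make this map injective with continuous inverse, and completeness makes its
    range closed. *)
Lemma homeomorphic_closed : exists (F : FN) (i : X -> FN_space F)
    (r : FN_space F -> X),
  continuous T (FN_topology F) i /\ continuous (FN_topology F) T r /\
  (forall x, r (i x) = x) /\ forall y, i (r y) = y.
Proof.
destruct dist as [nn [idd [sym tri]]].
destruct small_clopen_covers as [V [sV cover]].
pose (phi := fun x k => least (fun j => V k j x)).
assert (phiE : forall x k j, phi x k = j <->
          V k j x /\ forall m, m < j -> ~ V k m x).
{ intros x k j; destruct (least_spec _ (cover k x)) as [h1 h2]; fold (phi x k) in h1, h2.
  split.
  - intros <-; split; [exact h1|]; intros m hm Vm; specialize (h2 m Vm); lia.
  - intros [h3 h4]; specialize (h2 j h3).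
    destruct (Nat.eq_dec (phi x k) j); [assumption|].
    destruct (h4 (phi x k)); [lia | exact h1]. }
assert (phi_clopen : forall z n,
   T (fun x => agree n z (phi x)) /\ is_closed T (fun x => agree n z (phi x))).
{ intros z n; apply clopen_all_lt; intro k.
  replace (fun x => phi x k = z k)
    with (fun x => V k (z k) x /\ forall m, m < z k -> ~ V k m x).
  - apply clopen_inter; [split; apply sV|].
    apply clopen_all_lt; intro m; apply clopen_compl; split; apply sV.
  - apply pred_ext; intro x; now rewrite phiE. }
assert (phi_dist : forall n x y, agree (S n) (phi x) (phi y) ->
          (d x y <= / INR (S n))%R).
{ intros n x y h; specialize (h n (Nat.lt_succ_diag_r n)).
  apply (sV n (phi x n)).
  - now apply (proj1 (phiE x n (phi x n))).
  - now apply (proj1 (phiE y n (phi x n))). }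
assert (phi_inj : forall x y, phi x = phi y -> x = y).
{ intros x y e; apply idd; apply Rle_antisym; [|apply nn].
  apply Rnot_lt_le; intro h; destruct (radius_small h) as [k hk].
  specialize (phi_dist k x y); rewrite e in phi_dist.
  specialize (phi_dist (@agree_refl _ _)); lra. }
assert (range_closed : is_closed Baire_topology (fun z => exists x, phi x = z)).
{ intros z nz; apply NNPP; intro no; apply nz; clear nz.
  assert (near : forall n, exists! x, D x /\ agree n z (phi x) /\
            forall y, D y -> agree n z (phi y) -> index x <= index y).
  { intro n.
    destruct (least_spec (fun i => exists x, D x /\ agree n z (phi x) /\ index x = i))
      as [[x [Dx [zx e]]] h].
    - assert (ex : exists x, agree n z (phi x)).
      { apply NNPP; intro nex; apply no; exists n; intros y zy [x <-].
        apply nex; now exists x. }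
      destruct (dense _ (proj1 (phi_clopen z n)) ex) as [x [Dx zx]].
      now exists (index x), x.
    - exists x; split.
      + split; [exact Dx|]; split; [exact zx|]; intros y Dy zy; rewrite e.
        apply h; now exists y.
      + intros y [Dy [zy hy]]; apply index_inj; [exact Dx|exact Dy|].
        assert (index y <= index x) by now apply hy.
        assert (index x <= index y) by (rewrite e; apply h; now exists y).
        lia. }
  apply unique_choice in near; destruct near as [u hu].
  assert (cauchy : forall n m, n <= m -> agree n z (phi (u m))).
  { intros n m h; apply (agree_le _ _ _ _ h), hu. }
  destruct (complete u) as [l hl].
  { intros e he; destruct (radius_small he) as [k hk]; exists (S k); intros n m hn hm.
    apply Rle_lt_trans with (2 := hk), phi_dist.
    apply agree_trans with z; [apply agree_sym|]; now apply cauchy. }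
  (* If [phi l] left the ball of [z], a clopen condition, then so would [phi] of all points near
     [l], among them late terms of [u]. *)
  exists l; symmetry; apply limit_unique_agree; intro n.
  apply NNPP; intro nl.
  destruct (phi_clopen z n) as [_ cl]; unfold is_closed in cl.
  rewrite openE in cl; destruct (cl l nl) as [e [he hb]].
  destruct (hl e he) as [n0 hn0].
  apply (hb (u (max n n0))); [rewrite sym; apply hn0; lia | apply cauchy; lia]. }
pose (F := exist _ _ range_closed : FN).
pose (i := fun x => exist _ (phi x) (ex_intro _ x eq_refl) : FN_space F).
assert (inv : forall y : FN_space F, exists! x, phi x = proj1_sig y).
{ intros [y [x e]]; exists x; split; [exact e|].
  intros x' e'; apply phi_inj; simpl in e'; congruence. }
destruct (unique_choice _ inv) as [r hr].
exists F, i, r; split; [|split; [|split]].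
- intros W oW; rewrite FN_open in oW; apply open_local; intros x Wx.
  destruct (oW _ Wx) as [n hn].
  exists (fun y => agree n (phi x) (phi y)); split; [apply phi_clopen|].
  split; [apply agree_refl|]; intros y hy; now apply hn.
- intros U oU; apply FN_open; intros y Uy.
  rewrite openE in oU; destruct (oU _ Uy) as [e [he hU]].
  destruct (radius_small he) as [k hk]; exists (S k); intros y' h.
  apply hU; apply Rle_lt_trans with (2 := hk), phi_dist; now rewrite !hr.
- intro x; apply phi_inj; now rewrite hr.
- intro y; destruct (hr y); specialize (hr y); unfold i.
  destruct y as [y hy]; simpl in hr; apply eq_sig_hprop; [|exact hr].
  intros; apply proof_irrelevance.
Qed.
End Embedding.

(** * The reduction from trees *)

Definition lift (Y Z : FN) (f : Baire -> Baire)
    (h : forall x, proj1_sig Y x -> proj1_sig Z (f x)) (y : FN_space Y) :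
    FN_space Z :=
  exist _ (f (proj1_sig y)) (h _ (proj2_sig y)).

Lemma lift_continuous (Y Z : FN) (f : Baire -> Baire) h :
  (forall n, exists m, forall x x', agree m x x' -> agree n (f x) (f x')) ->
  continuous (FN_topology Y) (FN_topology Z) (@lift Y Z f h).
Proof.
intro hf; apply FN_continuous; intros y n; destruct (hf n) as [m hm].
exists m; intros y' a; now apply hm.
Qed.

Lemma FN_point_eq (Y : FN) (y y' : FN_space Y) :
  proj1_sig y = proj1_sig y' -> y = y'.
Proof.
destruct y as [y hy], y' as [y' hy']; simpl; intros ->; f_equal.
apply proof_irrelevance.
Qed.

Definition full : FN.
Proof.
exists (fun _ => True); intros x h; tauto.
Defined.

(** * Nonempty closed sets as retracts of the Baire space *)

Section Retraction.
Variable Y : Baire -> Prop.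

Definition prefix (s : list nat) : Prop :=
  exists y, Y y /\ position y (length s) = s.

Definition next (s : list nat) (a : nat) : nat :=
  if excluded_middle_informative (prefix (s ++ [a])) then a
  else least (fun b => prefix (s ++ [b])).

Fixpoint forced (x : Baire) (n : nat) : list nat :=
  match n with
  | 0 => []
  | S n => forced x n ++ [next (forced x n) (x n)]
  end.

(** Each entry of [x] is kept as long as the prefix can still be extended into [Y], and otherwise
    replaced by the least admissible one. *)
Definition force (x : Baire) : Baire := fun n => next (forced x n) (x n).

Lemma position_force x n : position (force x) n = forced x n.
Proof.
induction n as [|n IH]; [reflexivity|]; now rewrite position_S, IH.
Qed.

Lemma prefix_position y n : Y y -> prefix (position y n).
Proof. intro Yy; exists y; now rewrite position_length. Qed.

Lemma prefix_next s a : prefix s -> prefix (s ++ [next s a]).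
Proof.
intro hs; unfold next; destruct (excluded_middle_informative _) as [h|_];
  [exact h|].
apply (@least_spec (fun b => prefix (s ++ [b]))).
destruct hs as [y [Yy e]]; exists (y (length s)).
rewrite <- e at 1; rewrite <- position_S; now apply prefix_position.
Qed.

Lemma force_prefix x n : (exists y, Y y) -> prefix (position (force x) n).
Proof.
intros [y Yy]; rewrite position_force; induction n as [|n IH].
- now exists y.
- now apply prefix_next.
Qed.

Lemma forced_fix x n : Y x -> forced x n = position x n.
Proof.
intro Yx; induction n as [|n IH]; [reflexivity|].
rewrite position_S; simpl; rewrite IH; f_equal; f_equal; unfold next.
rewrite <- position_S; destruct (excluded_middle_informative _) as [_|h];
  [reflexivity|].
now destruct h; apply prefix_position.
Qed.

Lemma force_fix x : Y x -> force x = x.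
Proof.
intro Yx; apply limit_unique_agree; intro n; apply position_agree.
now rewrite position_force, forced_fix.
Qed.

Lemma force_agree n x x' : agree n x x' -> agree n (force x) (force x').
Proof.
intro h; apply position_agree; rewrite !position_force.
induction n as [|n IH]; [reflexivity|]; simpl.
rewrite (h n) by lia; rewrite IH; [reflexivity|].
apply (agree_le _ (S n)); [lia | exact h].
Qed.
End Retraction.

(** All prefixes of a forced sequence are prefixes of points of [Y], so closedness puts it in [Y].
    Forcing fixes [Y] and preserves agreement of prefixes, hence is continuous. *)
Lemma FN_retract_full (Y : FN) : (exists y, proj1_sig Y y) ->
  retract (FN_topology Y) (FN_topology full).
Proof.
intro ne.
assert (h : forall x, proj1_sig full x -> proj1_sig Y (force (proj1_sig Y) x)).
{ intros x _; apply FN_closed; intro n.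
  destruct (@force_prefix (proj1_sig Y) x n ne) as [y [Yy e]]; exists y; split; [exact Yy|].
  apply position_agree; rewrite position_length in e; now symmetry. }
exists (@lift Y full (fun x => x) (fun _ _ => I)), (@lift full Y _ h).
split; [|split].
- apply lift_continuous; intro n; now exists n.
- apply lift_continuous; intro n; exists n; intros; now apply force_agree.
- intros [y Yy]; apply FN_point_eq; simpl; now apply force_fix.
Qed.

(** * The closed set attached to a tree *)

Definition left_part (z : Baire) : Baire := fun n => fst (of_nat (pred (z n))).

(* A nonzero entry [S (to_nat (b, w))] prolongs a branch [b] of the tree coded
   by [c], together with an arbitrary sequence [w]; a zero entry leaves the tree
   for good, so that every sequence reaching a zero is isolated. *)
Definition branching (c z : Baire) : Prop := forall n,
  (z n = 0 -> z (S n) = 0) /\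
  (z n <> 0 -> c (code (position c (S n)) (position (left_part z) (S n))) = 0).

Lemma left_part_agree n z z' : agree n z z' -> agree n (left_part z) (left_part z').
Proof. intros h k hk; unfold left_part; now rewrite h. Qed.

Lemma branching_closed2 : closed2 branching.
Proof.
intros c z h; apply not_all_ex_not in h; destruct h as [n h].
exists (max (S (S n)) (S (code (position c (S n)) (position (left_part z) (S n))))).
intros c' z' hc hz h'; apply h; specialize (h' n).
rewrite <- (proj2 (position_agree _ c c')), <- (proj2 (position_agree _ (left_part z) (left_part z'))) in h'.
- rewrite (hz n), (hz (S n)), (hc (code _ _)) in h' by lia; exact h'.
- apply left_part_agree; eapply agree_le; [|exact hz]; lia.
- eapply agree_le; [|exact hc]; lia.
Qed.

Definition attach (F : FN) (c : Baire) : FN.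
Proof.
exists (fun x => (x 0 = 0 /\ proj1_sig F (shift x)) \/
                 (x 0 = 1 /\ branching c (shift x))).
intros x nx.
destruct (Nat.eq_dec (x 0) 0) as [e0|n0]; [|destruct (Nat.eq_dec (x 0) 1) as [e1|n1]].
- destruct (proj2_sig F (shift x)) as [n hn]; [tauto|].
  exists (S n); intros y hy; rewrite (hy 0) by lia.
  apply shift_agree in hy; specialize (hn _ hy); intuition lia.
- destruct (@branching_closed2 c (shift x)) as [n hn]; [tauto|].
  exists (S n); intros y hy; rewrite (hy 0) by lia.
  apply shift_agree in hy; specialize (hn c _ (agree_refl _ _) hy); intuition lia.
- exists 1; intros y hy; rewrite (hy 0) by lia; intuition lia.
Defined.

Definition truncate (n : nat) (x : Baire) : Baire :=
  fun k => if k <? n then x k else 0.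

Lemma truncate_agree n x : agree n x (truncate n x).
Proof. intros k hk; unfold truncate; now rewrite (proj2 (Nat.ltb_lt k n) hk). Qed.

(** A sequence that leaves the tree at stage [n] is tested at stages below [n] only, so its
    membership survives small changes of [c]. *)
Lemma truncate_branching n c c' z :
  (forall k, k < n -> c' (code (position c' (S k)) (position (left_part z) (S k)))
     = c (code (position c (S k)) (position (left_part z) (S k)))) ->
  branching c z -> branching c' (truncate n z).
Proof.
intros h hz k; destruct (hz k) as [h1 h2]; split.
- unfold truncate; destruct (Nat.ltb_spec k n), (Nat.ltb_spec (S k) n); auto; lia.
- unfold truncate at 1; destruct (Nat.ltb_spec k n); [|tauto].
  intro nz.
  rewrite <- (proj2 (position_agree (S k) (left_part z) (left_part (truncate n z)))).
  + rewrite h by assumption; now apply h2.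
  + apply left_part_agree, (agree_le _ n); [lia|apply truncate_agree].
Qed.

(** The isolated points serve this purpose: a point of the tree part in [U] can be replaced by a
    long truncation, which stays in the attached set for all [c'] near [c]. Having a branch in [U]
    would not be an open condition. *)
Lemma attach_open (F : FN) (U : Baire -> Prop) : Baire_topology U ->
  Baire_topology (fun c => exists x, proj1_sig (attach F c) x /\ U x).
Proof.
intros oU c [x [[[x0 Fx]|[x0 bx]] Ux]].
- exists 0; intros c' _; exists x; split; [left|]; tauto.
- destruct (oU x Ux) as [n hn].
  destruct (strict_bound (fun k =>
    code (position c (S k)) (position (left_part (shift x)) (S k))) n) as [m hm].
  exists (max n m); intros c' hc.
  exists (prepend 1 (truncate n (shift x))); split; [right; split; [reflexivity|]|].
  + change (shift (prepend ?a ?y)) with y.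
    apply truncate_branching with (c := c); [|exact bx].
    intros k hk.
    rewrite <- (proj2 (position_agree (S k) c c')).
    * apply hc; specialize (hm k hk); cbv beta in hm; lia.
    * apply (agree_le _ (max n m)); [lia | exact hc].
  + apply hn; intros [|k] hk; [now rewrite x0|].
    apply (truncate_agree (n := n) (shift x)); lia.
Qed.

(** Along a branch [b], the map [i] carries an arbitrary sequence as second component and [r] reads
    it back, so the Baire space is a retract of the attached set; [FN_retract_full] gives the
    converse. *)
Lemma ill_founded_same_full (F : FN) c : ill_founded c ->
  same_hierarchy (FN_topology (attach F c)) (FN_topology full).
Proof.
intros [b hb].
pose (i := fun w : Baire => prepend 1 (fun n => S (to_nat (b n, w n)))).
pose (r := fun (x : Baire) n => snd (of_nat (pred (shift x n)))).
assert (hi : forall w, proj1_sig full w -> proj1_sig (attach F c) (i w)).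
{ intros w _; right; split; [reflexivity|]; intro n; split; [discriminate|].
  intros _; replace (left_part _) with b; [apply hb|].
  apply functional_extensionality; intro k; unfold left_part, i, shift, prepend.
  now rewrite Nat.pred_succ, cancel_of_to. }
apply represented_same_hierarchy; apply retract_represented.
- apply FN_retract_full; exists (i b); now apply hi.
- exists (@lift _ _ _ hi), (@lift (attach F c) full r (fun _ _ => I)).
  split; [|split].
  + apply lift_continuous; intro n; exists n; intros w w' h [|k] hk; [reflexivity|].
    unfold i, prepend; rewrite (h k) by lia; reflexivity.
  + apply lift_continuous; intro n; exists (S n); intros x x' h k hk.
    unfold r, shift; now rewrite (h (S k)) by lia.
  + intros [w hw]; apply FN_point_eq; simpl.
    apply functional_extensionality; intro k; unfold r, shift, i, prepend.
    now rewrite Nat.pred_succ, cancel_of_to.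
Qed.

(** A sequence without zeros would yield a branch; once a zero is reached, only zeros can follow. *)
Lemma well_founded_isolated c z : ~ ill_founded c -> branching c z ->
  exists n, forall z', branching c z' -> agree n z z' -> z' = z.
Proof.
intros wf hz.
assert (ex : exists n, z n = 0).
{ apply NNPP; intro no; apply wf; exists (left_part z); intro n.
  apply hz; intro e; apply no; now exists n. }
destruct ex as [n zn].
assert (const : forall y, branching c y -> y n = 0 -> forall k, n <= k -> y k = 0).
{ intros y hy yn k h; induction h as [|k _ IH]; [exact yn|]; now apply hy. }
exists (S n); intros z' hz' h.
apply functional_extensionality; intro k.
destruct (Nat.le_gt_cases n k).
- now rewrite !const by (try assumption; rewrite h by lia; exact zn).
- apply h; lia.
Qed.

Lemma attach_isolated (F : FN) c (y : FN_space (attach F c)) :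
  ~ ill_founded c -> proj1_sig y 0 = 1 ->
  exists n, forall y', agree n (proj1_sig y) (proj1_sig y') -> y' = y.
Proof.
intros wf y0; destruct (proj2_sig y) as [[e _]|[_ hy]]; [lia|].
destruct (well_founded_isolated wf hy) as [n hn].
exists (S n); intros y' h; apply FN_point_eq.
assert (e' : proj1_sig y' 0 = 1) by (rewrite (h 0) by lia; exact y0).
destruct (proj2_sig y') as [[e _]|[_ hy']]; [lia|].
apply functional_extensionality; intros [|k]; [lia|].
apply (f_equal (fun z => z k) (hn _ hy' (shift_agree _ _ _ h))).
Qed.

(** The added points are isolated and form a clopen set. A nonconstant trace on [F] absorbs them; a
    set with constant trace is clopen and matches a trivial or a clopen subset of [F], the latter
    available because [F] has two points. *)
Lemma well_founded_same (F : FN) c :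
  (exists x y, proj1_sig F x /\ proj1_sig F y /\ x <> y) -> ~ ill_founded c ->
  same_hierarchy (FN_topology (attach F c)) (FN_topology F).
Proof.
intros [p [q [Fp [Fq pq]]]] wf.
assert (hi : forall x, proj1_sig F x -> proj1_sig (attach F c) (prepend 0 x))
  by (intros x Fx; now left).
pose (i := @lift _ _ _ hi).
assert (ci : continuous (FN_topology F) (FN_topology (attach F c)) i).
{ apply lift_continuous; intro n; exists n; intros x x' h [|k] hk; [reflexivity|].
  apply h; lia. }
assert (first : forall y : FN_space (attach F c),
    proj1_sig y 0 = 0 \/ proj1_sig y 0 = 1).
{ intro y; destruct (proj2_sig y) as [[y0 _]|[y0 _]]; auto. }
pose proof (fun y => @attach_isolated F c y wf) as isolated.
(* The projection of the copy of [F] onto [F] extends continuously by arbitrary values on the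
   isolated points. *)
assert (glue : forall g : FN_space (attach F c) -> FN_space F,
  exists f : FN_space (attach F c) -> FN_space F,
    continuous (FN_topology (attach F c)) (FN_topology F) f /\
    (forall x, f (i x) = x) /\
    (forall y, proj1_sig y 0 = 0 -> i (f y) = y) /\
    (forall y, proj1_sig y 0 = 1 -> f y = g y)).
{ intro g.
  assert (h0 : forall y : FN_space (attach F c), proj1_sig y 0 = 0 ->
             proj1_sig F (shift (proj1_sig y))).
  { intros [y [[y0 Fy]|[y0 by_]]]; simpl; [auto | congruence]. }
  pose (f := fun y : FN_space (attach F c) =>
     match Nat.eq_dec (proj1_sig y 0) 0 with
     | left e => exist _ (shift (proj1_sig y)) (h0 y e) : FN_space F
     | right _ => g y
     end).
  assert (f0 : forall y, proj1_sig y 0 = 0 ->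
             proj1_sig (f y) = shift (proj1_sig y)).
  { intros y e; unfold f; destruct (Nat.eq_dec _ 0); [reflexivity | contradiction]. }
  exists f; split; [|split; [|split]].
  - apply FN_continuous; intros y n.
    destruct (Nat.eq_dec (proj1_sig y 0) 0) as [e|e].
    + exists (S n); intros y' h.
      assert (e' : proj1_sig y' 0 = 0) by (rewrite (h 0) by lia; exact e).
      rewrite (f0 y e), (f0 y' e'); now apply shift_agree.
    + destruct (first y) as [|y0]; [lia|].
      destruct (isolated y y0) as [m hm].
      exists m; intros y' h; rewrite (hm y' h); apply agree_refl.
  - intros x; apply FN_point_eq; now rewrite f0.
  - intros y e; apply FN_point_eq; simpl; rewrite f0 by exact e.
    apply functional_extensionality; intros [|k]; [now symmetry | reflexivity].
  - intros y e; unfold f; destruct (Nat.eq_dec _ 0) as [e0|_];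
      [discriminate (eq_trans (eq_sym e) e0) | reflexivity]. }
pose (p' := exist _ p Fp : FN_space F).
pose (q' := exist _ q Fq : FN_space F).
apply represented_same_hierarchy.
- intro B.
  destruct (classic (exists b, forall x, B (i x) <-> b)) as [[b hb]|nt].
  + destruct (glue (fun _ => p')) as [f [cf [fi [if0 _]]]].
    destruct (classic (forall y, B y <-> b)) as [all|nall].
    * exists (fun _ => b); split.
      { exists f; split; [exact cf|]; intro y; symmetry; apply all. }
      { exists i; split; [exact ci | exact hb]. }
    (* A set with constant trace on [F] is open; applied to [B] and to its complement, this makes
       [B] clopen. *)
    * assert (op : forall V b', (forall x, V (i x) <-> b') ->
                 FN_topology (attach F c) V).
      { intros V b' hV; apply FN_open; intros y Vy; destruct (first y) as [y0|y0].
        - exists 1; intros y' h.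
          rewrite <- (if0 y y0), hV in Vy.
          rewrite <- (if0 y'), hV; [exact Vy|].
          exact (eq_trans (h 0 Nat.lt_0_1) y0).
        - destruct (isolated y y0) as [n hn]; exists n; intros y' h.
          now rewrite (hn y' h). }
      assert (ex : exists k, p k <> q k).
      { apply NNPP; intro no; apply pq; apply functional_extensionality; intro k.
        apply NNPP; intro ne; apply no; now exists k. }
      destruct ex as [k hk].
      (* This ball is clopen, contains [p] and misses [q], which differs from [p] at [k]. *)
      exists (fun x => agree (S k) p (proj1_sig x)).
      apply not_all_ex_not in nall; destruct nall as [y hy].
      pose proof (hb p') as hp; apply clopen_equireducible.
      { now apply op with b. }
      { apply op with (~ b); intro x; now rewrite hb. }
      { apply FN_open_ball. }
      { apply FN_open; intros x nx; exists (S k); intros x' h h'; apply nx.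
        apply agree_trans with (proj1_sig x'); [exact h' | now apply agree_sym]. }
      (* The points [i p'] and [y] lie on different sides of [B]; the truth value [b] decides which
         is inside. *)
      { destruct (classic b); [exists (i p') | exists y]; tauto. }
      { destruct (classic b); [exists y | exists (i p')]; tauto. }
      { exists p'; apply agree_refl. }
      { exists q'; intro h; apply hk; symmetry; apply h; lia. }
  + assert (x1 : exists x, B (i x)).
    { apply NNPP; intro no; apply nt; exists False; intro x; split; [|tauto].
      intro Bx; apply no; now exists x. }
    assert (x2 : exists x, ~ B (i x)).
    { apply NNPP; intro no; apply nt; exists True; intro x; split; [tauto|].
      intros _; apply NNPP; intro nB; apply no; now exists x. }
    destruct x1 as [x1 h1], x2 as [x2 h2].
    (* An isolated point goes to a point of [F] inside or outside the trace, according to its own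
       membership in [B]. *)
    destruct (glue (fun y => if excluded_middle_informative (B y) then x1 else x2))
      as [f [cf [_ [if0 if1]]]].
    exists (fun x => B (i x)); split.
    * exists f; split; [exact cf|]; intro y; destruct (first y) as [y0|y0].
      { now rewrite if0. }
      rewrite if1 by exact y0.
      destruct (excluded_middle_informative (B y)); tauto.
    * exists i; split; [exact ci | tauto].
- apply retract_represented; destruct (glue (fun _ => p')) as [f [cf [fi _]]].
  now exists i, f.
Qed.

(** * Discrete spaces and the conclusion *)

Definition empty : FN.
Proof.
exists (fun _ => False); intros x _; exists 0; tauto.
Defined.

(* In a discrete space a set that is neither empty nor full reduces every set,
   so only the classes of the empty and of the full set are incomparable, and
   these are minimal. *)
Lemma discrete_hierarchy (X : Type) (T : Topology X) (a b c : wadge_hierarchy T) :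
  (forall U, T U) -> ~ wadge_hierarchy_le a b -> ~ wadge_hierarchy_le b a ->
  wadge_hierarchy_le c a -> wadge_hierarchy_le a c.
Proof.
intros dis nab nba [C [A [hC [hA [f [_ hf]]]]]].
assert (rep : forall e : wadge_hierarchy T, exists E, proj1_sig e E).
{ intros [e [E hE]]; exists E; apply hE, equireducible_refl. }
destruct (rep b) as [B hB].
assert (red : forall E E' : X -> Prop, (exists x, E' x) -> (exists x, ~ E' x) ->
                reduces T T E E').
{ intros E E' [p hp] [q hq].
  exists (fun x => if excluded_middle_informative (E x) then p else q).
  split; [intros U _; apply dis|]; intro x.
  destruct (excluded_middle_informative (E x)); tauto. }
assert (trivial : (forall x, A x) \/ (forall x, ~ A x)).
{ apply NNPP; intro no; apply nba; exists B, A; split; [exact hB|].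
  split; [exact hA|]; apply red; apply NNPP; intro h; apply no.
  - right; intros x hx; apply h; now exists x.
  - left; intros x; apply NNPP; intro hx; apply h; now exists x. }
exists A, C; split; [exact hA|]; split; [exact hC|].
exists (fun x => x); split; [apply continuous_id|]; intro x.
specialize (hf x); destruct trivial as [h|h]; specialize (h x) as h1;
  specialize (h (f x)); tauto.
Qed.

Definition wadge_class (X : Type) (T : Topology X) (A : X -> Prop) :
  wadge_hierarchy T := exist _ (wadge_equiv T A) (ex_intro _ A (fun B => iff_refl _)).

Lemma wadge_class_le (X : Type) (T : Topology X) (A B : X -> Prop) :
  wadge_hierarchy_le (wadge_class T A) (wadge_class T B) <-> wadge_le T A B.
Proof.
split.
- intros [A' [B' [[h1 _] [[_ h2] h]]]].
  exact (reduces_trans h1 (reduces_trans h h2)).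
- intro h; exists A, B; split; [apply equireducible_refl|].
  split; [apply equireducible_refl | exact h].
Qed.

(** In the Baire space a singleton is closed and not open, hence incomparable with its complement,
    but it lies strictly above the empty set. [discrete_hierarchy] excludes this pattern for
    discrete spaces. *)
Lemma full_not_discrete (X : Type) (T : Topology X) :
  (forall U, T U) -> ~ same_hierarchy T (FN_topology full).
Proof.
intros dis h; apply same_hierarchy_sym in h.
destruct h as [f [_ [_ [_ hf]]]].
pose (o := exist _ (fun _ => 0) I : FN_space full).
pose (A := fun x : FN_space full => x = o).
assert (no : ~ FN_topology full A).
{ intro op; rewrite FN_open in op; destruct (op o eq_refl) as [n hn].
  specialize (hn (exist _ (fun k => if k <? n then 0 else 1) I)); simpl in hn.
  assert (e : exist (fun _ : Baire => True) (fun k => if k <? n then 0 else 1) I = o).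
  { apply hn; intros k hk; now rewrite (proj2 (Nat.ltb_lt k n) hk). }
  apply (f_equal (fun y => proj1_sig y n)) in e; simpl in e.
  now rewrite Nat.ltb_irrefl in e. }
assert (cl : FN_topology full (fun x => ~ A x)).
{ apply FN_open; intros x nx.
  assert (ex : exists k, proj1_sig x k <> 0).
  { apply NNPP; intro all; apply nx; apply FN_point_eq; simpl.
    apply functional_extensionality; intro k; apply NNPP; intro ne.
    apply all; now exists k. }
  destruct ex as [k hk]; exists (S k); intros y hy ->; apply hk.
  symmetry; apply hy; lia. }
pose (cA := wadge_class (FN_topology full) A).
pose (cB := wadge_class (FN_topology full) (fun x => ~ A x)).
pose (cE := wadge_class (FN_topology full) (fun _ => False)).
assert (h : wadge_hierarchy_le (f cA) (f cE)).
{ apply (@discrete_hierarchy _ _ (f cA) (f cB) (f cE) dis);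
    rewrite <- hf; unfold cA, cB, cE; rewrite wadge_class_le.
  - intros [g [cg hg]]; apply no.
    replace A with (fun x => ~ A (g x)) by now apply pred_ext.
    apply (cg _ cl).
  - intros [g [cg hg]]; apply no.
    replace A with (fun x => ~ A (g x)); [exact (cg _ cl)|].
    apply pred_ext; intro x; rewrite hg; split; [apply NNPP | tauto].
  - exists (fun _ => exist _ (fun _ => 1) I); split.
    + apply FN_continuous; intros y n; exists 0; intros; apply agree_refl.
    + intro x; split; [|tauto]; intro e.
      apply (f_equal (fun y => proj1_sig y 0)) in e; discriminate. }
rewrite <- hf in h; unfold cA, cE in h; rewrite wadge_class_le in h.
destruct h as [g [_ hg]]; exact (proj2 (hg o) eq_refl).
Qed.

Lemma well_founded_discrete c : ~ ill_founded c ->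
  forall U, FN_topology (attach empty c) U.
Proof.
intros wf U; apply FN_open; intros y Uy.
assert (y0 : proj1_sig y 0 = 1) by (destruct (proj2_sig y) as [[_ []]|[h _]]; exact h).
destruct (attach_isolated y wf y0) as [n hn]; exists n; intros y' h.
now rewrite (hn y' h).
Qed.

Lemma same_hierarchy_not_borel (cc : countable_choice) (F : FN) :
  (exists x y, proj1_sig F x /\ proj1_sig F y /\ x <> y) ->
  ~ effros_borel (fun Y => same_hierarchy (FN_topology Y) (FN_topology F)).
Proof.
intros two hB; apply well_founded_not_analytic.
(* In the first case the well-founded trees are the preimage of the complement, in the second that
   of the set itself; both preimages are analytic. *)
destruct (classic (same_hierarchy (FN_topology F) (FN_topology full))) as [hF|hF].
- destruct (effros_borel_bianalytic cc (attach empty) (@attach_open empty) _ hB)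
    as [_ h].
  apply analytic_ext with (2 := h); intro c; split.
  + intros nB ill; apply nB; apply same_hierarchy_trans with (S := FN_topology full).
    * now apply ill_founded_same_full.
    * now apply same_hierarchy_sym.
  + intros wf B; apply (full_not_discrete (well_founded_discrete wf)).
    now apply same_hierarchy_trans with (S := FN_topology F).
- destruct (effros_borel_bianalytic cc (attach F) (@attach_open F) _ hB) as [h _].
  apply analytic_ext with (2 := h); intro c; split.
  + intros B ill; apply hF.
    apply same_hierarchy_trans with (S := FN_topology (attach F c)).
    * now apply same_hierarchy_sym.
    * now apply ill_founded_same_full.
  + intro wf; now apply well_founded_same.
Qed.

Unset Implicit Arguments.

Theorem theorem2 (X : Type) (T : Topology X)
  (hDC : DC_R)
  (hpolish : polish T)
  (hzero : zero_dimensional T)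
  (htwo : exists x y : X, x <> y)
  (hAD : ~ countable (fun _ : X => True) -> AD) :
  ~ effros_borel (fun Y : FN =>
      order_isomorphic (@wadge_hierarchy_le (FN_space Y) (FN_topology Y))
                       (@wadge_hierarchy_le X T)).
Proof.
pose proof (DC_R_countable_choice hDC) as cc.
destruct hpolish as [[D [[index inj] dense]] [d [dist [complete openE]]]].
(* Homeomorphic spaces have the same hierarchy, so [X] may be replaced by a closed subset [F] of the
   Baire space. *)
destruct (homeomorphic_closed dist complete openE D index inj dense hzero cc)
  as [F [i [r [ci [cr [ri ir]]]]]].
assert (XF : same_hierarchy T (FN_topology F))
  by exact (homeomorphic_same_hierarchy ci cr ri ir).
assert (two : exists x y, proj1_sig F x /\ proj1_sig F y /\ x <> y).
{ destruct htwo as [x [y xy]].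
  exists (proj1_sig (i x)), (proj1_sig (i y)).
  split; [apply proj2_sig|]; split; [apply proj2_sig|]; intro e; apply xy.
  rewrite <- (ri x), <- (ri y); f_equal; now apply FN_point_eq. }
intro hB; apply (same_hierarchy_not_borel cc two).
replace (fun Y => same_hierarchy (FN_topology Y) (FN_topology F))
  with (fun Y : FN => same_hierarchy (FN_topology Y) T); [exact hB|].
apply pred_ext; intro Y; split; intro h.
- now apply same_hierarchy_trans with (S := T).
- apply same_hierarchy_trans with (S := FN_topology F); [exact h|].
  now apply same_hierarchy_sym.
Qed.
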